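(* For every positive integer $d$, the fundamental group $\Pi(H(d,2))$ of the Hamming graph $H(d,2)$ is trivial: $\Pi(H(d,2))\cong\{e\}$.
   Context: The Hamming graph $H(d,2)$ has vertex set $\{0,1\}^d$, with two vertices adjacent if and only if they differ in exactly one coordinate. A walk of length $n$ in a graph is a sequence of vertices $(v_0v_1\cdots v_n)$ with $v_i$ adjacent to $v_{i+1}$ for all $0\le i<n$. Two walks are equivalent, written $\simeq$ (homotopic rel endpoints for $\times$-homotopy), if one can be transformed into the other by a finite sequence of the following moves: (1) spider moves: replacing a single interior vertex $v_k$ ($0<k<n$) of a walk by another vertex $v_k'$ such that the result is again a walk (so $v_k'$ is adjacent to both $v_{k-1}$ and $v_{k+1}$); (2) prunes: if $v_i=v_{i+2}$, deleting the entries $v_i,v_{i+1}$ from the walk; (3) anti-prunes: the inverse operation of a prune. For a connected graph $G$ and a vertex $v$ of $G$, the fundamental group $\Pi(G)$ is the set of equivalence classes of closed walks starting and ending at $v$, with concatenation of walks as the group operation. For Hamming graphs the base vertex is $\mathbf{0}=(0,\ldots,0)$. *)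

(* Defs.v *)
From Stdlib Require Import Relation_Operators.
From HB Require Import structures.
From mathcomp Require Import all_boot generic_quotient.
From mathcomp Require Import boolp.

Set Implicit Arguments.
Unset Strict Implicit.
Unset Printing Implicit Defensive.

(* Undirected graphs without multiple edges; as usual for x-homotopy, loops
   are not excluded. *)
Record graph := Graph {
  vertex :> choiceType;
  adj : rel vertex;
  adj_sym : symmetric adj
}.
Arguments adj {g} : rename.

Section Walks.
Variable G : graph.
Implicit Types (s t a b : seq G) (v x y z : G).

(* The sequence [:: v_0; ...; v_n] of the n + 1 vertices of a walk of
   length n; it is never empty. *)
Definition is_walk s : bool := (s != [::]) && sorted adj s.

(* In Spider, the replaced vertex has a predecessor y and a successor z, so it
   is interior; in Prune, the entries y, z with y = v_i = v_(i+2) are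
   deleted. *)
Inductive move : seq G -> seq G -> Prop :=
| Spider s t y z x x' :
    is_walk (s ++ [:: y, x, z & t]) -> is_walk (s ++ [:: y, x', z & t]) ->
    move (s ++ [:: y, x, z & t]) (s ++ [:: y, x', z & t])
| Prune s t y z :
    is_walk (s ++ [:: y, z, y & t]) ->
    move (s ++ [:: y, z, y & t]) (s ++ y :: t)
| AntiPrune s t y z :
    is_walk (s ++ [:: y, z, y & t]) ->
    move (s ++ y :: t) (s ++ [:: y, z, y & t]).

Definition walk_equiv : seq G -> seq G -> Prop := clos_refl_trans _ move.

(* The second walk has to start where the first one ends; this common vertex
   is listed only once. *)
Definition walk_cat s t : seq G := s ++ behead t.

Definition is_closed_walk v s : bool :=
  [&& is_walk s, head v s == v & last v s == v].

Lemma sorted_split a y b :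
  sorted adj (a ++ y :: b) = sorted adj (rcons a y) && path adj y b.
Proof.
case: a => [|c a] //=.
by rewrite cat_path rcons_path /= andbA.
Qed.

Lemma move_sym s t : move s t -> move t s.
Proof. by case=> *; constructor. Qed.

Lemma move_ends v s t :
  move s t -> [/\ s != [::], head v s = head v t & last v s = last v t].
Proof.
by case=> [[|c a] *|[|c a] *|[|c a] *]; split=> //=; rewrite !last_cat.
Qed.

Lemma move_walk s t : move s t -> is_walk s /\ is_walk t.
Proof.
have pr a b y z : is_walk (a ++ [:: y, z, y & b]) -> is_walk (a ++ y :: b).
  rewrite /is_walk => /andP[_]; rewrite !sorted_split => /andP[-> /=].
  by case/and3P=> _ _ ->; rewrite andbT; case: a.
by case=> // a b y z w; split=> //; apply: pr w.
Qed.

Lemma move_ctx a b s t :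
  is_walk (a ++ s ++ b) -> is_walk (a ++ t ++ b) -> move s t ->
  move (a ++ s ++ b) (a ++ t ++ b).
Proof.
move=> ws wt m; case: m ws wt => [c d y z x x' _ _|c d y z _|c d y z _].
- by rewrite -!catA !cat_cons !(catA a); apply: Spider.
- by rewrite -!catA !cat_cons !(catA a) => ws _; apply: Prune.
- by rewrite -!catA !cat_cons !(catA a) => _; apply: AntiPrune.
Qed.

Lemma walk_ctx a b s t :
  move s t -> is_walk (a ++ s ++ b) -> is_walk (a ++ t ++ b).
Proof.
move=> m; have [] := move_walk m.
case: m => [c d y z x x' _ _|c d y z _|c d y z _] /andP[_ +] /andP[_ +] /andP[_ +];
  rewrite /is_walk -!catA !cat_cons !(catA a) !sorted_split /= !cat_path /=.
- move=> /andP[_ /and3P[_ _ _]] /andP[_ /and3P[-> -> ->]].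
  by move=> /andP[-> /and4P[_ _ _ ->]]; case: (a ++ c).
- move=> _ _ /andP[-> /and4P[_ _ -> ->]]; by case: (a ++ c).
- move=> _ /andP[_ /and3P[-> -> ->]] /andP[-> /andP[_ ->]].
  by case: (a ++ c).
Qed.

Lemma walk_equiv_ctx a b s t :
  walk_equiv s t -> is_walk (a ++ s ++ b) ->
  is_walk (a ++ t ++ b) /\ walk_equiv (a ++ s ++ b) (a ++ t ++ b).
Proof.
elim=> {s t} [s t m w|s w|s t u _ IH1 _ IH2 w].
- have w' := walk_ctx m w; split=> //.
  by apply: rt_step; apply: move_ctx.
- by split=> //; apply: rt_refl.
- have [w1 e1] := IH1 w; have [w2 e2] := IH2 w1; split=> //.
  exact: rt_trans e1 e2.
Qed.

Lemma walk_equiv_refl s : walk_equiv s s.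
Proof. exact: rt_refl. Qed.

Lemma walk_equiv_sym s t : walk_equiv s t -> walk_equiv t s.
Proof.
elim=> {s t} [s t m|s|s t u _ IH1 _ IH2].
- by apply: rt_step; apply: move_sym.
- exact: rt_refl.
- exact: rt_trans IH2 IH1.
Qed.

Lemma walk_equiv_trans s t u :
  walk_equiv s t -> walk_equiv t u -> walk_equiv s u.
Proof. exact: rt_trans. Qed.

Lemma is_walk_rev s : is_walk (rev s) = is_walk s.
Proof.
rewrite /is_walk rev_sorted -size_eq0 size_rev size_eq0; congr (_ && _).
by apply: eq_sorted => x y; rewrite adj_sym.
Qed.

Lemma move_rev s t : move s t -> move (rev s) (rev t).
Proof.
have r2 a b x y z : rev (a ++ [:: y, x, z & b]) = rev b ++ [:: z, x, y & rev a].
  by rewrite rev_cat !rev_cons -!cats1 -!catA.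
have r1 a b y : rev (a ++ y :: b) = rev b ++ y :: rev a.
  by rewrite rev_cat !rev_cons -!cats1 -!catA.
by case=> a b y z => [x x' w w'|w|w]; rewrite ?(r2, r1); constructor;
  rewrite -r2 is_walk_rev.
Qed.

Lemma walk_equiv_rev s t : walk_equiv s t -> walk_equiv (rev s) (rev t).
Proof.
elim=> {s t} [s t m|s|s t u _ IH1 _ IH2].
- by apply: rt_step; apply: move_rev.
- exact: rt_refl.
- exact: rt_trans IH1 IH2.
Qed.

(* A walk followed by its reverse prunes to a walk of length 0. *)
Lemma walk_equiv_catV s x :
  is_walk (rcons s x) -> is_walk (rcons s x ++ rev s) /\
  walk_equiv (rcons s x ++ rev s) [:: head x s].
Proof.
elim/last_ind: s x => [x w|s y IH x w]; first by split=> //; apply: rt_refl.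
have yx : adj y x.
  move: w => /andP[_]; rewrite -cats1 cat_rcons sorted_split.
  by case/andP=> _ /=; rewrite andbT.
have wy : is_walk (rcons s y).
  move: w => /andP[_]; rewrite -cats1 cat_rcons sorted_split => /andP[w _].
  by rewrite /is_walk w andbT; case: (s).
have [w1 e1] := IH y wy.
have E : rcons (rcons s y) x ++ rev (rcons s y) = s ++ [:: y, x, y & rev s].
  by rewrite rev_rcons -!cats1 -!catA.
have w2 : is_walk (s ++ [:: y, x, y & rev s]).
  move: w1; rewrite /is_walk cat_rcons !sorted_split /= => /andP[_ /andP[-> ->]].
  by rewrite yx adj_sym yx; case: (s).
rewrite E; split=> //; apply: rt_trans (rt_step _ _ _ _ (Prune w2)) _.
by rewrite -cat_rcons; case: (s) e1.
Qed.

Lemma closed_walkP v s :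
  reflect (exists p, [/\ s = v :: p, path adj v p & last v p = v])
          (is_closed_walk v s).
Proof.
apply: (iffP idP) => [|[p [-> wp lp]]].
  case: s => // x p /and3P[/= wp /eqP xv /eqP lp].
  by subst x; exists p; split.
by rewrite /is_closed_walk /is_walk /= wp lp !eqxx.
Qed.

Lemma closed_walkP_last v s :
  is_closed_walk v s -> exists p, s = rcons p v /\ head v p = v.
Proof.
case: s => // y s /and3P[_ /= /eqP hy /eqP]; rewrite hy lastI => lv.
exists (belast v s); rewrite {1}lv; split=> //.
by case: (s).
Qed.

End Walks.

Local Open Scope quotient_scope.

Section FundamentalGroup.
Variables (G : graph) (v : G).

Record closed_walk := ClosedWalk {
  walk_seq :> seq G;
  walk_seqP : is_closed_walk v walk_seq
}.
HB.instance Definition _ := [isSub for walk_seq].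
HB.instance Definition _ := [Choice of closed_walk by <:].
Implicit Types s t u : closed_walk.

Definition homotopic s t : bool := `[< walk_equiv s t >].

Lemma homotopicP s t : reflect (walk_equiv s t) (homotopic s t).
Proof. exact: asboolP. Qed.

Lemma homotopic_refl : reflexive homotopic.
Proof. by move=> s; apply/homotopicP/walk_equiv_refl. Qed.

Lemma homotopic_sym : symmetric homotopic.
Proof.
by move=> s t; apply/homotopicP/homotopicP => /walk_equiv_sym.
Qed.

Lemma homotopic_trans : transitive homotopic.
Proof.
move=> t s u /homotopicP st /homotopicP tu.
by apply/homotopicP; apply: walk_equiv_trans st tu.
Qed.

Canonical homotopic_equiv :=
  EquivRel homotopic homotopic_refl homotopic_sym homotopic_trans.

Fact closed_cat_subproof s t : is_closed_walk v (walk_cat s t).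
Proof.
have /closed_walkP[p [-> wp lp]] := walk_seqP s.
have /closed_walkP[q [-> wq lq]] := walk_seqP t.
apply/closed_walkP; exists (p ++ q); split=> //.
  by rewrite cat_path wp lp.
by rewrite last_cat lp.
Qed.
Definition closed_cat s t := ClosedWalk (closed_cat_subproof s t).

Fact closed_const_subproof : is_closed_walk v [:: v].
Proof. by apply/closed_walkP; exists [::]. Qed.
Definition closed_const := ClosedWalk closed_const_subproof.

Fact closed_rev_subproof s : is_closed_walk v (rev s).
Proof.
have /closed_walkP[p [es wp lp]] := walk_seqP s.
have /and3P[w _ _] := walk_seqP s.
rewrite /is_closed_walk is_walk_rev w es rev_cons last_rcons eqxx andbT.
by rewrite -rev_cons lastI rev_rcons /= lp.
Qed.
Definition closed_rev s := ClosedWalk (closed_rev_subproof s).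

Lemma homotopic_cat s s' t t' :
  homotopic s s' -> homotopic t t' ->
  homotopic (closed_cat s t) (closed_cat s' t').
Proof.
move=> /homotopicP ss /homotopicP tt; apply/homotopicP.
have wk (r : closed_walk) : is_walk r by case/and3P: (walk_seqP r).
apply: (@walk_equiv_trans _ _ (closed_cat s' t)).
  have := @walk_equiv_ctx G [::] (behead t) _ _ ss.
  by rewrite !cat0s => -[] //; apply: (wk (closed_cat s t)).
have [p [es _]] := closed_walkP_last (walk_seqP s').
have E (r : closed_walk) : val (closed_cat s' r) = p ++ r ++ [::].
  have /closed_walkP[q [er _ _]] := walk_seqP r.
  by rewrite /= /walk_cat es er /= cats0 cat_rcons.
have := @walk_equiv_ctx G p [::] _ _ tt.
by rewrite -!E => -[] //; apply: wk (closed_cat s' t).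
Qed.

Lemma homotopic_rev s s' :
  homotopic s s' -> homotopic (closed_rev s) (closed_rev s').
Proof.
by move=> /homotopicP ss; apply/homotopicP; apply: walk_equiv_rev.
Qed.

Lemma closed_catA : associative closed_cat.
Proof.
move=> s t u; apply: val_inj => /=; rewrite /walk_cat /=.
by have /closed_walkP[q [-> _ _]] := walk_seqP t; rewrite /= catA.
Qed.

Lemma closed_cat1 : left_id closed_const closed_cat.
Proof.
move=> s; apply: val_inj => /=; rewrite /walk_cat /=.
by have /closed_walkP[q [-> _ _]] := walk_seqP s.
Qed.

Lemma closed_cat_const : right_id closed_const closed_cat.
Proof. by move=> s; apply: val_inj; rewrite /= /walk_cat cats0. Qed.

Lemma closed_revK : involutive closed_rev.
Proof. by move=> s; apply: val_inj; rewrite /= revK. Qed.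

Lemma closed_catV s : homotopic (closed_cat s (closed_rev s)) closed_const.
Proof.
apply/homotopicP; rewrite /= /walk_cat.
have [p [es hp]] := closed_walkP_last (walk_seqP s).
have /and3P[w _ _] := walk_seqP s.
rewrite es in w *; rewrite rev_rcons /=.
by have [_] := walk_equiv_catV w; rewrite hp.
Qed.

Definition fundamental_group := {eq_quot homotopic_equiv}.
Local Notation Pi := fundamental_group.
HB.instance Definition _ := Choice.on Pi.
HB.instance Definition _ := EqQuotient.on Pi.

Definition pi_mul (x y : Pi) : Pi := \pi_Pi (closed_cat (repr x) (repr y)).
Definition pi_one : Pi := \pi_Pi closed_const.
Definition pi_inv (x : Pi) : Pi := \pi_Pi (closed_rev (repr x)).

Lemma pi_eq s t : homotopic s t -> \pi_Pi s = \pi_Pi t.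
Proof. by move=> h; apply/eqmodP. Qed.

Lemma repr_pi s : homotopic (repr (\pi_Pi s)) s.
Proof. by apply/(@eqmodP _ homotopic_equiv); rewrite reprK. Qed.

(* The operations, defined on representatives, do not depend on their choice. *)
Lemma pi_mulE s t :
  pi_mul (\pi_Pi s) (\pi_Pi t) = \pi_Pi (closed_cat s t).
Proof. by apply: pi_eq; apply: homotopic_cat; apply: repr_pi. Qed.

Lemma pi_invE s : pi_inv (\pi_Pi s) = \pi_Pi (closed_rev s).
Proof. by apply: pi_eq; apply: homotopic_rev; apply: repr_pi. Qed.

Lemma pi_mulA : associative pi_mul.
Proof.
elim/quotW=> s; elim/quotW=> t; elim/quotW=> u.
by rewrite (pi_mulE t u) (pi_mulE s t) (pi_mulE s) (pi_mulE _ u) closed_catA.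
Qed.

Lemma pi_mul1 : left_id pi_one pi_mul.
Proof. by elim/quotW=> s; rewrite pi_mulE closed_cat1. Qed.

Lemma pi_mul_one : right_id pi_one pi_mul.
Proof. by elim/quotW=> s; rewrite pi_mulE closed_cat_const. Qed.

Lemma pi_mulV : right_inverse pi_one pi_inv pi_mul.
Proof.
by elim/quotW=> s; rewrite pi_invE pi_mulE; apply/pi_eq/closed_catV.
Qed.

Lemma pi_Vmul : left_inverse pi_one pi_inv pi_mul.
Proof.
elim/quotW=> s; rewrite pi_invE pi_mulE; apply: pi_eq.
by rewrite -{2}(closed_revK s); apply: closed_catV.
Qed.

HB.instance Definition _ :=
  isGroup.Build Pi pi_mulA pi_mul1 pi_mul_one pi_Vmul pi_mulV.

End FundamentalGroup.

Definition trivial_group := unit.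
HB.instance Definition _ := Choice.on trivial_group.

Definition triv_mul (_ _ : trivial_group) : trivial_group := tt.
Definition triv_inv (_ : trivial_group) : trivial_group := tt.

Fact triv_mulA : associative triv_mul. Proof. by []. Qed.
Fact triv_mul1 : left_id (tt : trivial_group) triv_mul. Proof. by case. Qed.
Fact triv_mul_one : right_id (tt : trivial_group) triv_mul. Proof. by case. Qed.
Fact triv_Vmul : left_inverse (tt : trivial_group) triv_inv triv_mul.
Proof. by []. Qed.
Fact triv_mulV : right_inverse (tt : trivial_group) triv_inv triv_mul.
Proof. by []. Qed.

HB.instance Definition _ := isGroup.Build trivial_group
  triv_mulA triv_mul1 triv_mul_one triv_Vmul triv_mulV.

(* The library's \isog relates subgroups of finite groups only. *)
Definition isomorphic (A B : groupType) : Prop :=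
  exists f : {multiplicative A -> B}, bijective f.

Section Hamming.
Variable d : nat.

Definition hamming_vertex := {ffun 'I_d -> 'I_2}.

Definition hamming_adj : rel hamming_vertex :=
  fun x y => #|[set i | x i != y i]| == 1.

Fact hamming_adj_sym : symmetric hamming_adj.
Proof.
move=> x y; rewrite /hamming_adj; congr (_ == _); apply: eq_card => i.
by rewrite !inE eq_sym.
Qed.

Definition hamming : graph := Graph hamming_adj_sym.

Definition hamming0 : hamming := [ffun=> ord0].

End Hamming.

(* Main.v *)
Require Import Defs.
From mathcomp Require Import all_boot.
From mathcomp Require Import generic_quotient.
From Stdlib Require Import Relation_Operators.

(** The cube has the base vertex [hamming0 d] at the bottom when a vertex has
    as height its weight, the number of its nonzero coordinates.  A closed walk
    of positive length at the bottom goes up first and ends at height [0], so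
    somewhere it has a peak: consecutive vertices [y], [x], [z] with [y] and
    [z] lower than [x].  If [y = z], a prune removes the peak.  Otherwise [y]
    and [z] arise from [x] by setting two different nonzero coordinates to
    zero; setting both to zero gives a common neighbour [x'] of [y] and [z]
    below [x], and the spider move from [x] to [x'] lowers the walk.  Either
    move decreases the sum of the heights of the entries of the walk, so
    repeating them ends at the walk of length [0].

    The argument uses of the cube only that adjacent vertices have different
    heights and that two different lower neighbours [y], [z] of [x] have a
    common neighbour lower than [x]; it is carried out for any graph with such
    a height in [closed_walk_null], and [weight_diamond] supplies the second
    property for the cube. *)

Set Implicit Arguments.
Unset Strict Implicit.
Unset Printing Implicit Defensive.

Section Height.
Variables (G : graph) (h : G -> nat).
Implicit Types (v x y z : G) (s p : seq G).
Hypothesis adj_h : forall x y, adj x y -> h x != h y.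
Hypothesis diamond : forall x y z,
  adj x y -> adj x z -> h y < h x -> h z < h x -> y != z ->
  exists x', [/\ adj x' y, adj x' z & h x' < h x].

(** A walk that starts upwards and comes down to height [0] has to turn down
    at some entry, since no step is level. *)
Lemma exists_peak y x p :
  path adj y (x :: p) -> h y < h x -> h (last x p) = 0 ->
  exists a b y' x' z',
    [/\ [:: y, x & p] = a ++ [:: y', x', z' & b], h y' < h x' & h z' < h x'].
Proof.
elim: p y x => [|z p IH] y x /= /andP[_ wp] yx hl; first by rewrite hl in yx.
have /andP[xz _] := wp.
have := adj_h xz; rewrite neq_ltn => /orP[xz_up|zx]; last first.
  by exists [::], p, y, x, z.
have [a [b [y' [x' [z' [E y'x' z'x']]]]]] := IH x z wp xz_up hl.
by exists (y :: a), b, y', x', z'; rewrite E.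
Qed.

(** Removing or lowering a peak decreases the total height of the walk; a peak
    is strictly above its neighbours, so also a prune loses height. *)
Lemma closed_walk_null v s :
  h v = 0 -> is_closed_walk v s -> walk_equiv s [:: v].
Proof.
move=> hv; have [n] := ubnP (\sum_(x <- s) h x).
elim: n s => // n IH s le_n cs.
have /closed_walkP[[|x p] [Es wp lp]] := cs; first by rewrite Es; apply: rt_refl.
have vx : h v < h x by have /andP[/adj_h] := wp; rewrite hv lt0n eq_sym.
have hl : h (last x p) = 0 by rewrite [last _ _]lp.
have [a [b [y [t [z [E yt zt]]]]]] := exists_peak wp vx hl.
rewrite {}E in Es; subst s.
(* Moves keep the endpoints, so the result of a move is again closed at [v]. *)
have step s' : move (a ++ [:: y, t, z & b]) s' ->
    \sum_(x <- s') h x < \sum_(x <- a ++ [:: y, t, z & b]) h x ->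
    walk_equiv (a ++ [:: y, t, z & b]) [:: v].
  move=> m lt_s'; apply: rt_trans (rt_step _ _ _ _ m) _; apply: IH.
    by rewrite -ltnS; apply: leq_trans le_n; rewrite ltnS.
  have /and3P[_ /eqP hs /eqP ls] := cs.
  have [_ w'] := move_walk m; have [_ e1 e2] := move_ends v m.
  by rewrite /is_closed_walk w' -e1 -e2 hs ls !eqxx.
have /and3P[w _ _] := cs.
have [wa yt_adj tz_adj wb] :
    [/\ sorted adj (rcons a y), adj y t, adj t z & path adj z b].
  by move: w => /andP[_]; rewrite sorted_split /= => /andP[-> /and3P[-> -> ->]].
have [yz|yz] := eqVneq y z.
  subst z; apply: step; first exact: Prune.
  rewrite !big_cat !big_cons /= ltn_add2l ltn_add2l addnA -[ltnLHS]add0n ltn_add2r.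
  by rewrite addn_gt0 (leq_ltn_trans _ yt).
rewrite adj_sym in yt_adj.
have [t' [t'y t'z t't]] := diamond yt_adj tz_adj yt zt yz.
apply: (step (a ++ [:: y, t', z & b])).
  apply: Spider => //; rewrite /is_walk sorted_split wa /=.
  by rewrite [adj y _]adj_sym t'y t'z wb; case: (a).
by rewrite !big_cat !big_cons /= !ltn_add2l ltn_add2r.
Qed.

End Height.

Lemma isomorphic_trivial (G : graph) (v : G) :
  (forall s, is_closed_walk v s -> walk_equiv s [:: v]) ->
  isomorphic (fundamental_group v) trivial_group.
Proof.
move=> null; exists (@one_fun (fundamental_group v) trivial_group).
exists (fun=> pi_one v); last by case.
elim/quotW=> s; apply/esym/pi_eq/homotopicP/null.
exact: walk_seqP.
Qed.

Section Cube.
Variable d : nat.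
Implicit Types x y z : hamming d.

Definition weight x := #|[set i | x i != ord0]|.

Definition clear (i : 'I_d) x : hamming d :=
  [ffun k => if k == i then ord0 else x k].

Lemma weight_clear i x : x i != ord0 -> weight x = (weight (clear i x)).+1.
Proof.
move=> xi; rewrite /weight (cardsD1 i) inE xi; congr _.+1; apply: eq_card => k.
by rewrite !inE ffunE; case: eqP.
Qed.

Lemma adj_clear i x : x i != ord0 -> adj x (clear i x).
Proof.
move=> xi; apply/cards1P; exists i; apply/setP=> k; rewrite !inE ffunE.
by case: (eqVneq k i) => [->|_]; rewrite ?xi ?eqxx.
Qed.

(** As a coordinate takes only two values, one of two adjacent vertices has a
    zero in the coordinate where they differ. *)
Lemma adj_clearP x y : adj x y ->
  exists i, (x i != ord0 /\ y = clear i x) \/ (y i != ord0 /\ x = clear i y).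
Proof.
move=> /cards1P[i /setP D]; exists i.
have E k : k != i -> x k = y k.
  by move=> ki; apply/eqP; move: (D k); rewrite !inE (negPf ki) => /negbFE.
have := D i; rewrite !inE eqxx.
have [yi|yi] := eqVneq (y i) ord0 => xy; [left|right]; split=> //.
- by rewrite -yi.
- by apply/ffunP=> k; rewrite ffunE; case: (eqVneq k i) => [->//|/E].
- apply/ffunP=> k; rewrite ffunE; case: (eqVneq k i) => [->|/E //].
  by apply/val_inj; move: (x i) (y i) xy yi => [[|[|m]] Hm] [[|[|n]] Hn].
Qed.

Lemma adj_weight x y : adj x y -> weight x != weight y.
Proof.
by case/adj_clearP=> i [] [/weight_clear E ?]; subst; rewrite E neq_ltn ltnSn ?orbT.
Qed.

Lemma adj_weight_lt x y : adj x y -> weight y < weight x ->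
  exists2 i, x i != ord0 & y = clear i x.
Proof.
case/adj_clearP=> i [[xi ->] _|[yi ->]]; first by exists i.
by rewrite (weight_clear yi) ltnNge leqnSn.
Qed.

(** Lower neighbours clear one coordinate of [x] each; clearing both
    coordinates, in either order, completes the square below [x]. *)
Lemma weight_diamond x y z :
  adj x y -> adj x z -> weight y < weight x -> weight z < weight x -> y != z ->
  exists x', [/\ adj x' y, adj x' z & weight x' < weight x].
Proof.
move=> xy xz yx zx; case: (adj_weight_lt xy yx) => i xi ->.
case: (adj_weight_lt xz zx) => j xj -> ne.
have ij : i != j by apply: contraNneq ne => ->.
have yj : clear i x j != ord0 by rewrite ffunE [j == i]eq_sym (negPf ij).
have zi : clear j x i != ord0 by rewrite ffunE (negPf ij).
have C : clear j (clear i x) = clear i (clear j x).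
  by apply/ffunP=> k; rewrite !ffunE; do 2 case: ifP.
exists (clear j (clear i x)); split.
- by rewrite adj_sym adj_clear.
- by rewrite C adj_sym adj_clear.
- by rewrite (weight_clear xi) (weight_clear yj) ltnS leqnSn.
Qed.

Lemma weight0 : weight (hamming0 d) = 0.
Proof. by apply: eq_card0 => i; rewrite !inE ffunE. Qed.

End Cube.

Theorem corollary3p7 (d : nat) (d_gt0 : 0 < d) :
  isomorphic (fundamental_group (hamming0 d)) trivial_group.
Proof.
apply: isomorphic_trivial => s.
exact: (closed_walk_null (@adj_weight d) (@weight_diamond d) (weight0 d)).
Qed.
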